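(* Let $q\ge 1$ and let $D_1,D_2:n\to n$ be two $\mathrm{PBS}_q$-diagrams. If $\mathrm{PBS}\vdash D_1=D_2$, then $\llbracket D_1\rrbracket=\llbracket D_2\rrbracket$.
   Context: Fix an integer $q\ge 1$; write $[n]=\{0,\dots,n-1\}$. Syntax. $\mathrm{PBS}_q$-terms, each of a type $n\to n$ ($n\in\mathbb N$), are generated by: the empty diagram $\varepsilon:0\to0$, the wire $\mathrm{id}:1\to1$, the negation $\neg:1\to1$, the swap $\sigma:2\to2$, the polarising beam splitter $\beta:2\to2$, a gate $\gamma_U:1\to1$ for each $U\in\mathbb C^{q\times q}$; sequential composition $D_2\circ D_1:n\to n$ for $D_1,D_2:n\to n$; parallel composition $D_1\otimes D_2:n+m\to n+m$ for $D_1:n\to n$, $D_2:m\to m$; trace $Tr(D):n\to n$ for $D:n+1\to n+1$. A congruence is a type-preserving equivalence relation on terms compatible with $\circ$, $\otimes$ and $Tr$. Let $I_0=\varepsilon$, $I_{k+1}=I_k\otimes\mathrm{id}$; $\sigma_{1,0}=\mathrm{id}$, $\sigma_{1,k+1}=(I_k\otimes\sigma)\circ(\sigma_{1,k}\otimes\mathrm{id})$; $Tr_0(D)=D$, $Tr_{k+1}(D)=Tr(Tr_k(D))$. Diagrams are terms modulo the structural congruence, the smallest congruence containing all well-typed instances of: $(D_3\circ D_2)\circ D_1=D_3\circ(D_2\circ D_1)$; $I_k\circ D=D=D\circ I_k$; $\varepsilon\otimes D=D=D\otimes\varepsilon$; $(D_1\otimes D_2)\otimes D_3=D_1\otimes(D_2\otimes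 D_3)$; $(D_3\circ D_1)\otimes(D_4\circ D_2)=(D_3\otimes D_4)\circ(D_1\otimes D_2)$; $\sigma_{1,k}\circ(\mathrm{id}\otimes D)=(D\otimes\mathrm{id})\circ\sigma_{1,k}$ for $D:k\to k$; $\sigma\circ\sigma=I_2$; $Tr(D_1\otimes D_2)=D_1\otimes Tr(D_2)$; $Tr(D_2\circ(D_1\otimes\mathrm{id}))=Tr(D_2)\circ D_1$; $Tr((D_2\otimes\mathrm{id})\circ D_1)=D_2\circ Tr(D_1)$; $Tr_k((I_n\otimes D_2)\circ D_1)=Tr_k(D_1\circ(I_n\otimes D_2))$ for $D_2:k\to k$, $D_1:n+k\to n+k$; $Tr(\sigma)=\mathrm{id}$. Equational theory. $\mathrm{PBS}\vdash\cdot=\cdot$ is the smallest congruence containing the structural congruence and the following equations, for all $U,V\in\mathbb C^{q\times q}$ ($I$ is the identity matrix): (1) $\mathrm{id}=\gamma_I$; (2) $\gamma_U\circ\neg=\neg\circ\gamma_U$; (3) $\beta\circ(\gamma_U\otimes\gamma_U)=(\gamma_U\otimes\gamma_U)\circ\beta$; (4) $Tr((\mathrm{id}\otimes\gamma_V)\circ\beta\circ(\mathrm{id}\otimes\gamma_U)\circ\beta)=Tr((\mathrm{id}\otimes\gamma_U)\circ\beta)$; (5) $(\neg\otimes\neg)\circ\beta\circ(\neg\otimes\neg)=\sigma\circ\beta$; (6) $\gamma_V\circ\gamma_U=\gamma_{VU}$; (7) $Tr(\gamma_U)=\varepsilon$; (8) $\beta\circ\beta=\mathrm{id}\otimes\mathrm{id}$;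 (9) $(\beta\otimes\mathrm{id})\circ(\mathrm{id}\otimes\beta)\circ(\beta\otimes\mathrm{id})=(\sigma\otimes\mathrm{id})\circ(\mathrm{id}\otimes\beta)\circ(\sigma\otimes\mathrm{id})$; (10) $\beta\circ(\neg\otimes\mathrm{id})\circ\beta=(\neg\otimes\mathrm{id})\circ\beta\circ(\neg\otimes\mathrm{id})$. Denotational semantics. $\mathcal H_n=\mathbb C^{\{\rightarrow,\uparrow\}}\otimes\mathbb C^n\otimes\mathbb C^q$ with orthonormal basis $|c,p,x\rangle$, $c\in\{\rightarrow,\uparrow\}$, $p\in[n]$, $x\in[q]$. The linear map $\llbracket D\rrbracket:\mathcal H_n\to\mathcal H_n$ for $D:n\to n$ is defined inductively: $\llbracket\varepsilon\rrbracket=0$; $\llbracket\mathrm{id}\rrbracket$ is the identity; $\llbracket\neg\rrbracket$ exchanges $|\rightarrow,0,x\rangle$ and $|\uparrow,0,x\rangle$; $\llbracket\sigma\rrbracket|c,p,x\rangle=|c,1-p,x\rangle$; $\llbracket\beta\rrbracket|\rightarrow,p,x\rangle=|\rightarrow,p,x\rangle$, $\llbracket\beta\rrbracket|\uparrow,p,x\rangle=|\uparrow,1-p,x\rangle$; $\llbracket\gamma_U\rrbracket|c,0,x\rangle=|c,0\rangle\otimes U|x\rangle$; $\llbracket D_2\circ D_1\rrbracket=\llbracket D_2\rrbracket\circ\llbracket D_1\rrbracket$; $\llbracket D_1\otimes D_2\rrbracket=\llbracket D_1\rrbracket\boxplus\llbracket D_2\rrbracket$, where for $f$ on $\mathcal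 H_n$ and $g$ on $\mathcal H_m$, $f\boxplus g$ on $\mathcal H_{n+m}$ is $f\oplus g$ transported along the isomorphism $\mathcal H_n\oplus\mathcal H_m\cong\mathcal H_{n+m}$ sending $|c,p,x\rangle$ of the first summand to $|c,p,x\rangle$ and $|c,p,x\rangle$ of the second to $|c,p+n,x\rangle$; $\llbracket Tr(D)\rrbracket=\mathcal T(\llbracket D\rrbracket)$, where for $f$ on $\mathcal H_{n+1}$, $\mathcal T(f)=\sum_{k\in\mathbb N}\pi_1\circ(f\circ\pi_0)^k\circ f\circ\iota$ with $\iota:\mathcal H_n\to\mathcal H_{n+1}$ the inclusion $|c,p,x\rangle\mapsto|c,p,x\rangle$, $\pi_0:\mathcal H_{n+1}\to\mathcal H_{n+1}$ killing basis vectors with $p<n$ and fixing those with $p=n$, $\pi_1:\mathcal H_{n+1}\to\mathcal H_n$ sending $|c,p,x\rangle$ to itself if $p<n$ and to $0$ if $p=n$. (For maps arising from diagrams the sum has finitely many nonzero terms, and $\llbracket\cdot\rrbracket$ is invariant under structural congruence.) *)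

(* Defs.v *)
From HB Require Import structures.
From mathcomp Require Import all_boot all_algebra.
From mathcomp Require Import classical_sets fsbigop reals.
From mathcomp Require Export complex.
Set Implicit Arguments.
Unset Strict Implicit.
Unset Printing Implicit Defensive.
Import GRing.Theory.
Local Open Scope ring_scope.

(* [pbs K q n] is the type of the terms n -> n with gates in K^(q x q). *)
Inductive pbs (K : Type) (q : nat) : nat -> Type :=
| Empty : pbs K q 0
| Wire : pbs K q 1
| Neg : pbs K q 1
| Swap : pbs K q 2
| Beta : pbs K q 2
| Gate of 'M[K]_q : pbs K q 1
| Comp n of pbs K q n & pbs K q n : pbs K q n
| Par n m of pbs K q n & pbs K q m : pbs K q (n + m)
| Trace n of pbs K q (n + 1) : pbs K q n.

Arguments Empty {K q}.
Arguments Wire {K q}.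
Arguments Neg {K q}.
Arguments Swap {K q}.
Arguments Beta {K q}.

Declare Scope pbs_scope.
Delimit Scope pbs_scope with pbs.
Bind Scope pbs_scope with pbs.
Notation "D2 ∘ D1" := (Comp D2 D1) (at level 50, left associativity) : pbs_scope.
Notation "D1 ⊗ D2" := (Par D1 D2) (at level 40, left associativity) : pbs_scope.
Local Open Scope pbs_scope.

(* Types such as (n + m) + k and n + (m + k) are equal but not convertible:
   [cast] transports a term along such an equality and leaves it otherwise
   unchanged. *)
Definition cast (K : Type) (q n m : nat) (e : n = m) (D : pbs K q n) :
  pbs K q m := ecast k (pbs K q k) e D.

Fixpoint idn {K : Type} {q : nat} (k : nat) : pbs K q k :=
  match k with
  | 0 => Empty
  | k'.+1 => cast (addn1 k') (idn k' ⊗ Wire)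
  end.

Fixpoint swap1 {K : Type} {q : nat} (k : nat) : pbs K q (1 + k) :=
  match k with
  | 0 => Wire
  | k'.+1 => cast (addn2 k') (idn k' ⊗ Swap)
             ∘ cast (addn1 (1 + k')) (swap1 k' ⊗ Wire)
  end.

Fixpoint tracen {K : Type} {q : nat} (k n : nat) :
    pbs K q (n + k) -> pbs K q n :=
  match k with
  | 0 => fun D => cast (addn0 n) D
  | k'.+1 => fun D => Trace (tracen (cast (addnA n 1 k') D))
  end.

Definition pbs_rel (K : Type) (q : nat) :=
  forall n, pbs K q n -> pbs K q n -> Prop.

(* The smallest congruence containing [R]. *)
Inductive congr_closure (K : Type) (q : nat) (R : pbs_rel K q) : pbs_rel K q :=
| congr_base n (D D' : pbs K q n) : R n D D' -> congr_closure R D D'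
| congr_refl n (D : pbs K q n) : congr_closure R D D
| congr_sym n (D D' : pbs K q n) : congr_closure R D D' -> congr_closure R D' D
| congr_trans n (D D' D'' : pbs K q n) :
    congr_closure R D D' -> congr_closure R D' D'' -> congr_closure R D D''
| congr_comp n (D1 D1' D2 D2' : pbs K q n) :
    congr_closure R D1 D1' -> congr_closure R D2 D2' ->
    congr_closure R (D2 ∘ D1) (D2' ∘ D1')
| congr_par n m (D1 D1' : pbs K q n) (D2 D2' : pbs K q m) :
    congr_closure R D1 D1' -> congr_closure R D2 D2' ->
    congr_closure R (D1 ⊗ D2) (D1' ⊗ D2')
| congr_trace n (D D' : pbs K q (n + 1)) :
    congr_closure R D D' -> congr_closure R (Trace D) (Trace D').

Inductive struct_axiom (K : Type) (q : nat) : pbs_rel K q :=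
| st_compA n (D1 D2 D3 : pbs K q n) :
    struct_axiom ((D3 ∘ D2) ∘ D1) (D3 ∘ (D2 ∘ D1))
| st_id_comp n (D : pbs K q n) : struct_axiom (idn n ∘ D) D
| st_comp_id n (D : pbs K q n) : struct_axiom D (D ∘ idn n)
| st_empty_par n (D : pbs K q n) : struct_axiom (Empty ⊗ D) D
| st_par_empty n (D : pbs K q n) : struct_axiom D (cast (addn0 n) (D ⊗ Empty))
| st_parA n m k (D1 : pbs K q n) (D2 : pbs K q m) (D3 : pbs K q k) :
    struct_axiom ((D1 ⊗ D2) ⊗ D3) (cast (addnA n m k) (D1 ⊗ (D2 ⊗ D3)))
| st_interchange n m (D1 D3 : pbs K q n) (D2 D4 : pbs K q m) :
    struct_axiom ((D3 ∘ D1) ⊗ (D4 ∘ D2)) ((D3 ⊗ D4) ∘ (D1 ⊗ D2))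
| st_swap_nat k (D : pbs K q k) :
    struct_axiom (swap1 k ∘ (Wire ⊗ D)) (cast (addnC k 1) (D ⊗ Wire) ∘ swap1 k)
| st_swap_inv : struct_axiom (Swap ∘ Swap) (idn 2)
| st_tr_superpose n m (D1 : pbs K q n) (D2 : pbs K q (m + 1)) :
    struct_axiom (Trace (cast (addnA n m 1) (D1 ⊗ D2))) (D1 ⊗ Trace D2)
| st_tr_input n (D1 : pbs K q n) (D2 : pbs K q (n + 1)) :
    struct_axiom (Trace (D2 ∘ (D1 ⊗ Wire))) (Trace D2 ∘ D1)
| st_tr_output n (D1 : pbs K q (n + 1)) (D2 : pbs K q n) :
    struct_axiom (Trace ((D2 ⊗ Wire) ∘ D1)) (D2 ∘ Trace D1)
| st_tr_slide n k (D1 : pbs K q (n + k)) (D2 : pbs K q k) :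
    struct_axiom (tracen ((idn n ⊗ D2) ∘ D1)) (tracen (D1 ∘ (idn n ⊗ D2)))
| st_tr_swap : struct_axiom (Trace (n := 1) Swap) Wire.

Definition struct_congr (K : Type) (q : nat) : pbs_rel K q :=
  congr_closure (@struct_axiom K q).

Inductive pbs_axiom (K : fieldType) (q : nat) : pbs_rel K q :=
| ax_gate1 : pbs_axiom Wire (Gate 1%:M)
| ax_gate_neg (U : 'M[K]_q) : pbs_axiom (Gate U ∘ Neg) (Neg ∘ Gate U)
| ax_beta_gate (U : 'M[K]_q) :
    pbs_axiom (Beta ∘ (Gate U ⊗ Gate U)) ((Gate U ⊗ Gate U) ∘ Beta)
| ax_loop (U V : 'M[K]_q) :
    pbs_axiom
      (Trace (n := 1) ((Wire ⊗ Gate V) ∘ Beta ∘ (Wire ⊗ Gate U) ∘ Beta))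
      (Trace (n := 1) ((Wire ⊗ Gate U) ∘ Beta))
| ax_neg_beta : pbs_axiom ((Neg ⊗ Neg) ∘ Beta ∘ (Neg ⊗ Neg)) (Swap ∘ Beta)
| ax_gateM (U V : 'M[K]_q) : pbs_axiom (Gate V ∘ Gate U) (Gate (V *m U))
| ax_tr_gate (U : 'M[K]_q) : pbs_axiom (Trace (n := 0) (Gate U)) Empty
| ax_beta_beta : pbs_axiom (Beta ∘ Beta) (Wire ⊗ Wire)
| ax_beta3 :
    pbs_axiom ((Beta ⊗ Wire) ∘ (Wire ⊗ Beta) ∘ (Beta ⊗ Wire))
              ((Swap ⊗ Wire) ∘ (Wire ⊗ Beta) ∘ (Swap ⊗ Wire))
| ax_beta_neg_beta :
    pbs_axiom (Beta ∘ (Neg ⊗ Wire) ∘ Beta)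
              ((Neg ⊗ Wire) ∘ Beta ∘ (Neg ⊗ Wire)).

(* PBS |- D1 = D2 *)
Definition pbs_eq (K : fieldType) (q : nat) : pbs_rel K q :=
  congr_closure (fun n (D1 D2 : pbs K q n) =>
    struct_congr D1 D2 \/ pbs_axiom D1 D2).

(* A basis label (c, p, x); the polarisation c is [false] for the horizontal
   one (→) and [true] for the vertical one (↑). *)
Definition basis (q n : nat) : finType := (bool * 'I_n * 'I_q)%type.

(* The tensor product K^2 ⊗ K^n ⊗ K^q, as the coordinate space over [basis]. *)
Definition H (K : fieldType) (q n : nat) : vectType K :=
  {ffun basis q n -> K^o}.

Definition ket (K : fieldType) (q n : nat) (c : bool) (p : 'I_n) (x : 'I_q) :
  H K q n := [ffun b => (b == (c, p, x))%:R] : {ffun basis q n -> K^o}.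
Arguments ket {K q n} c p x.

(* [linext e] is the linear map sending |c,p,x> to [e c p x]. *)
Definition linext_fun (K : fieldType) (q n : nat) (W : vectType K)
    (e : bool -> 'I_n -> 'I_q -> W) (v : H K q n) : W :=
  \sum_(b : basis q n) (v : {ffun basis q n -> K^o}) b *: e b.1.1 b.1.2 b.2.

Fact linext_fun_is_linear (K : fieldType) (q n : nat) (W : vectType K)
  (e : bool -> 'I_n -> 'I_q -> W) : linear (@linext_fun K q n W e).
Proof.
move=> a u v; rewrite /linext_fun scaler_sumr -big_split /=.
by apply: eq_bigr => b _; rewrite !ffunE scalerDl scalerA.
Qed.

HB.instance Definition _ (K : fieldType) (q n : nat) (W : vectType K)
    (e : bool -> 'I_n -> 'I_q -> W) :=
  GRing.isLinear.Build K (H K q n) W *:%R (@linext_fun K q n W e)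
    (@linext_fun_is_linear K q n W e).

Definition linext (K : fieldType) (q n : nat) (W : vectType K)
    (e : bool -> 'I_n -> 'I_q -> W) : 'Hom(H K q n, W) :=
  linfun (linext_fun e).

Lemma linext_ket (K : fieldType) (q n : nat) (W : vectType K)
    (e : bool -> 'I_n -> 'I_q -> W) c p x : linext e (ket c p x) = e c p x.
Proof.
rewrite lfunE /= /linext_fun (bigD1 (c, p, x)) //= ffunE eqxx scale1r.
by rewrite big1 ?addr0 // => b /negPf bN; rewrite ffunE bN scale0r.
Qed.

Definition dsumv (K : fieldType) (V W : vectType K) : vectType K :=
  (V * W)%type.

(* The direct sum f ⊕ g, acting componentwise on pairs. *)
Definition dsum_fun (K : fieldType) (V W : vectType K)
    (f : 'End(V)) (g : 'End(W)) (uv : dsumv V W) : dsumv V W :=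
  (f uv.1, g uv.2).

Fact dsum_fun_is_linear (K : fieldType) (V W : vectType K)
  (f : 'End(V)) (g : 'End(W)) : linear (dsum_fun f g).
Proof. by move=> a u v; rewrite /dsum_fun !linearP. Qed.

HB.instance Definition _ (K : fieldType) (V W : vectType K)
    (f : 'End(V)) (g : 'End(W)) :=
  GRing.isLinear.Build K (dsumv V W) (dsumv V W) *:%R (dsum_fun f g)
    (dsum_fun_is_linear f g).

Definition dsum (K : fieldType) (V W : vectType K)
    (f : 'End(V)) (g : 'End(W)) : 'End(dsumv V W) :=
  linfun (dsum_fun f g).

(* The isomorphism H_n ⊕ H_m -> H_(n+m). *)
Definition glue_fun (K : fieldType) (q n m : nat)
    (uv : dsumv (H K q n) (H K q m)) : H K q (n + m) :=
  linext (fun c p x => ket c (lshift m p) x) uv.1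
  + linext (fun c p x => ket c (rshift n p) x) uv.2.

Fact glue_fun_is_linear (K : fieldType) (q n m : nat) :
  linear (@glue_fun K q n m).
Proof. by move=> a u v; rewrite /glue_fun !linearP /= scalerDr addrACA. Qed.

HB.instance Definition _ (K : fieldType) (q n m : nat) :=
  GRing.isLinear.Build K (dsumv (H K q n) (H K q m)) (H K q (n + m)) *:%R
    (@glue_fun K q n m) (@glue_fun_is_linear K q n m).

Definition glue (K : fieldType) (q n m : nat) :
    'Hom(dsumv (H K q n) (H K q m), H K q (n + m)) :=
  linfun (@glue_fun K q n m).

(* [glue] is bijective, and for such a map [^-1] is the inverse. *)
Definition boxplus (K : fieldType) (q n m : nat)
    (f : 'End(H K q n)) (g : 'End(H K q m)) : 'End(H K q (n + m)) :=
  (glue K q n m \o dsum f g \o (glue K q n m)^-1)%VF.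

Definition tr_incl (K : fieldType) (q n : nat) :
    'Hom(H K q n, H K q (n + 1)) :=
  linext (fun c p x => ket c (lshift 1 p) x).

Definition tr_pi0 (K : fieldType) (q n : nat) : 'End(H K q (n + 1)) :=
  linext (fun c p x => if (p < n)%N then 0 else ket c p x).

Definition tr_pi1 (K : fieldType) (q n : nat) :
    'Hom(H K q (n + 1), H K q n) :=
  linext (fun c p x => if split p is inl p' then ket c p' x else 0).

Definition lfun_pow (K : fieldType) (V : vectType K) (f : 'End(V)) (k : nat) :
  'End(V) := iter k (comp_lfun f) \1%VF.

(* The sum over all k in nat is that of a family of finite support (and is 0,
   by convention, if the support is infinite, which does not happen when f is
   the semantics of a term). *)
Definition tr_sem (K : fieldType) (q n : nat) (f : 'End(H K q (n + 1))) :
    'End(H K q n) :=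
  \sum_(k \in [set: nat]%classic)
    (tr_pi1 K q n \o (lfun_pow (f \o tr_pi0 K q n) k \o (f \o tr_incl K q n)))%VF.

Fixpoint sem (K : fieldType) (q n : nat) (D : pbs K q n) : 'End(H K q n) :=
  match D with
  | Empty => 0
  | Wire => \1%VF
  | Neg => linext (fun c p x => ket (~~ c) p x)
  | Swap => linext (fun c p x => ket c (rev_ord p) x)
  | Beta => linext (fun c p x => ket c (if c then rev_ord p else p) x)
  | Gate U => linext (fun c p x => \sum_(y < q) U y x *: ket c p y)
  | Comp _ D2 D1 => (sem D2 \o sem D1)%VF
  | Par _ _ D1 D2 => boxplus (sem D1) (sem D2)
  | Trace _ D => tr_sem (sem D)
  end.

(* Main.v *)
From mathcomp Require Import classical_sets fsbigop.
Require Import Defs.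
From mathcomp Require Import all_boot all_algebra reals complex.
From mathcomp Require Import zify.

(* A polarisation-position pair (c, p) entering a diagram follows a single
   classical path, during which the gates it meets compose to one matrix
   [M]: the semantics is |c,p,x> -> |c',p'> ⊗ M|x>, and (c, p) -> (c', p') is
   a bijection.  Injectivity is what makes traces terminate: no state of the
   looped wire can be visited twice.  Soundness
   therefore reduces to comparing, for each axiom, the paths and the matrices
   collected along them; the trace axioms amount to regrouping the steps of
   a path until its exit. *)

Set Implicit Arguments.
Unset Strict Implicit.
Unset Printing Implicit Defensive.
Import GRing.Theory.
Local Open Scope ring_scope.
Local Open Scope pbs_scope.

(** * Classical paths through a term *)

Definition state := (bool * nat)%type.
Definition outcome (K : fieldType) (q : nat) := (state * 'M[K]_q)%type.

(** Matrices act on column vectors, so the gate met last stands leftmost. *)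
Definition andthen (K : fieldType) (q : nat) (f : state -> outcome K q)
    (r : outcome K q) : outcome K q :=
  ((f r.1).1, (f r.1).2 *m r.2).

(* [f] is applied at most three times since the looped wire carries only two
   states; otherwise the value is junk. *)
Definition trace_run (K : fieldType) (q n : nat) (f : state -> outcome K q)
    (s : state) : outcome K q :=
  let r1 := f s in
  if (r1.1.2 < n)%N then r1 else
  let r2 := andthen f r1 in
  if (r2.1.2 < n)%N then r2 else andthen f r2.

(* Positions are plain natural numbers, so that [cast] is invisible; the value
   of [run D] outside the wires of [D] is junk. *)
Fixpoint run (K : fieldType) (q n : nat) (D : pbs K q n) (s : state) :
    outcome K q :=
  match D with
  | Empty | Wire => (s, 1%:M)
  | Neg => ((~~ s.1, s.2), 1%:M)
  | Swap => ((s.1, 1 - s.2)%N, 1%:M)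
  | Beta => ((s.1, if s.1 then (1 - s.2)%N else s.2), 1%:M)
  | Gate U => (s, U)
  | Comp _ D2 D1 => andthen (run D2) (run D1 s)
  | Par n m D1 D2 =>
      if (s.2 < n)%N then run D1 s else
      let r := run D2 (s.1, s.2 - n)%N in ((r.1.1, n + r.1.2)%N, r.2)
  | Trace n D => trace_run n (run D) s
  end.

(** * Injectivity of paths and termination of loops *)

Definition permutes (K : fieldType) (q N : nat) (f : state -> outcome K q) :=
  (forall s, (s.2 < N)%N -> ((f s).1.2 < N)%N) /\
  (forall s s', (s.2 < N)%N -> (s'.2 < N)%N -> (f s).1 = (f s').1 -> s = s').

(** If three consecutive steps ended on the looped wire, two of these states would coincide, as only
    two polarisations exist; cancelling [f] would then put the start [s] on the loop. Equal exits of
    two paths are likewise traced back to equal starts. *)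
Lemma trace_run_permutes (K : fieldType) (q n : nat) (f : state -> outcome K q) :
  permutes (n + 1) f -> permutes n (trace_run n f).
Proof.
move=> [fB fI].
have W (s : state) : (s.2 < n)%N -> (s.2 < n + 1)%N by lia.
split=> [s sn|s s' sn s'n].
  rewrite /trace_run; case: (ltnP (f s).1.2) => // h1.
  case: (ltnP (f _).1.2) => //= h2; rewrite ltnNge; apply/negP => h3.
  have b1 := fB _ (W _ sn); have b2 := fB _ b1; have b3 := fB _ b2.
  have n12 : (f s).1.1 != (f (f s).1).1.1.
    apply/eqP => e; have : s = (f s).1.
      apply: fI => //; first exact: W.
      by apply/eqP; rewrite -pair_eqE /= e eqxx /=; lia.
    by move=> es; move: h1; rewrite -es; lia.
  have [e|e] : (f (f (f s).1).1).1.1 = (f s).1.1 \/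
     (f (f (f s).1).1).1.1 = (f (f s).1).1.1.
    by move: n12; do 3 case: (_.1.1); auto.
  - have es : s = (f (f s).1).1.
      apply: fI => //; first exact: W.
      by apply/eqP; rewrite -pair_eqE /= e eqxx /=; lia.
    by move: h2; rewrite -es; lia.
  - have es : (f s).1 = (f (f s).1).1.
      apply: fI => //.
      by apply/eqP; rewrite -pair_eqE /= e eqxx /=; lia.
    by move: n12; rewrite {1}es eqxx.
have b s0 : (s0.2 < n)%N -> ((f s0).1.2 < n + 1)%N by move=> h; exact/fB/W.
have b' s0 : (s0.2 < n)%N -> ((f (f s0).1).1.2 < n + 1)%N by move=> h; exact/fB/b.
have ne t1 t2 : (t1.2 < n)%N -> (n <= t2.2)%N -> (t1 : state) = t2 -> False.
  by move=> h1 h2 e; move: h2; rewrite -e; lia.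
rewrite /trace_run.
case: (ltnP (f s).1.2) => h1; [|case: (ltnP (f (f s).1).1.2) => h2];
  (case: (ltnP (f s').1.2) => h1'; [|case: (ltnP (f (f s').1).1.2) => h2']);
  rewrite /= => e; move: (W _ sn) (W _ s'n) => ws ws';
  (* Cancels [f] on both sides. For paths of different lengths, a start ends up equal to a state on
     the loop, which [ne] excludes. *)
  repeat (match goal with
  | H : (f ?u).1 = (f ?v).1 |- _ =>
     have {}H : u = v by (apply: (fI _ _ _ _ H); auto) end);
  try by [auto]; exfalso; eauto.
Qed.

Lemma run_permutes (K : fieldType) (q n : nat) (D : pbs K q n) :
  permutes n (run D).
Proof.
elim: D => {n} /=.
- by split=> -[].
- by split=> -[].
- by split=> // -[c p] [c' p'] //= _ _ [/negb_inj-> ->].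
- split=> [[c p]|[c p] [c' p']] //=; first lia.
  by move=> h h' [-> e]; congr (_, _); lia.
- split=> [[[] p]|[[] p] [[] p']] //=; first lia.
  by move=> h h' [e]; congr (_, _); lia.
- by move=> U; split=> -[].
- move=> n D2 [B2 I2] D1 [B1 I1]; split=> /= [s /B1/B2 //|s s' sn s'n e].
  by apply: I1 => //; apply: I2 => //; apply: B1.
- move=> n m D1 [B1 I1] D2 [B2 I2]; split=> [s sn|s s' sn s'n].
    case: (ltnP s.2) => h; first by have := B1 _ h; lia.
    by have := B2 (s.1, s.2 - n)%N; rewrite /=; lia.
  case: (ltnP s.2) => h; case: (ltnP s'.2) => h' /=; first exact: I1.
  - by move=> e; have := B1 _ h; rewrite e /=; lia.
  - by move=> e; have := B1 _ h'; rewrite -e /=; lia.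
  - move=> [e1 e2].
    have e : (run D2 (s.1, s.2 - n)%N).1 = (run D2 (s'.1, s'.2 - n)%N).1.
      by apply/eqP; rewrite -pair_eqE /= e1 eqxx /=; lia.
    have [e3 e4] : (s.1, s.2 - n)%N = (s'.1, s'.2 - n)%N.
      by apply: I2 e => /=; lia.
    by apply/eqP; rewrite -pair_eqE /= e3 eqxx /=; lia.
- by move=> n D; exact: trace_run_permutes.
Qed.

Lemma run_lt (K : fieldType) (q n : nat) (D : pbs K q n) s :
  (s.2 < n)%N -> ((run D s).1.2 < n)%N.
Proof. exact: (run_permutes D).1. Qed.

(** * Paths through casts, identities and iterated swaps *)

Lemma run_cast (K : fieldType) (q n m : nat) (e : n = m) (D : pbs K q n) :
  run (cast e D) = run D.
Proof. by case: m / e. Qed.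

Lemma run_idn (K : fieldType) (q k : nat) s :
  (s.2 < k)%N -> run (idn k : pbs K q k) s = (s, 1%:M).
Proof.
elim: k s => // k IH [c p] /= pk; rewrite run_cast /=.
by case: ltnP => h; rewrite ?IH //= subnKC.
Qed.

Lemma run_swap1 (K : fieldType) (q k : nat) c p :
  (p < 1 + k)%N ->
  run (swap1 k : pbs K q (1 + k)) (c, p) =
  ((c, if p == 0%N then k else p.-1), 1%:M).
Proof.
elim: k p => [|k IH] p pk; first by case: p pk.
rewrite /= !run_cast /=; case: ltnP => h.
  rewrite /andthen IH //= mulmx1.
  case: eqP => e; first by rewrite ltnn subnn subn0 addn1.
  by rewrite ifT ?run_idn //=; lia.
rewrite /andthen /= mulmx1 ifF; last by lia.
by congr (_, _, _); case: eqP; lia.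
Qed.

(** * Iterating a step until the path leaves the loop *)

(** Unlike [trace_run], this sets no bound on the number of steps: it allows induction on the path
    and handles several looped wires at once. *)
Inductive exit (K : fieldType) (q n : nat) (f : state -> outcome K q) :
    state -> outcome K q -> Prop :=
| exit_now s : ((f s).1.2 < n)%N -> exit n f s (f s)
| exit_later s r : (n <= (f s).1.2)%N -> exit n f (f s).1 r ->
    exit n f s (r.1, r.2 *m (f s).2).

(** Iteration is deterministic. Trace equations are obtained from this by showing that both sides
    are exits of one and the same iteration. *)
Lemma exit_uniq (K : fieldType) (q n : nat) (f : state -> outcome K q) s r r' :
  exit n f s r -> exit n f s r' -> r = r'.
Proof.
move=> h; elim: h r' => {s r} [s h|s r h _ IH] r'.
  move E: s => s1 h'; case: h' E => // {}s1 r1 h1 _ e.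
  by move: h1; rewrite -e leqNgt h.
move E: s => s1 h'; case: h' E => {s1 r'} [s1 h1 e|s1 r1 _ h1 e].
  by move: h1; rewrite -e ltnNge h.
by move: h1; rewrite -e => /IH ->.
Qed.

Lemma exit_lt (K : fieldType) (q n : nat) (f : state -> outcome K q) s r :
  exit n f s r -> (r.1.2 < n)%N.
Proof. by elim. Qed.

(** The cutoff of [trace_run] after three steps truncates no path: by [run_lt] for [Trace D], the
    last step taken is an exit. *)
Lemma exit_run_Trace (K : fieldType) (q n : nat) (D : pbs K q (n + 1)) s :
  (s.2 < n)%N -> exit n (run D) s (run (Trace D) s).
Proof.
move=> sn; have := run_lt (Trace D) sn.
rewrite /= /trace_run; case: (ltnP (run D s).1.2) => [h1 _|h1]; first exact: exit_now.
case: (ltnP (run D _).1.2) => /= h2 h3; first by apply: exit_later => //; exact: exit_now.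
rewrite /andthen /= mulmxA.
apply: (exit_later (r := andthen (run D) (run D (run D s).1))) => //.
by apply: exit_later => //; exact: exit_now.
Qed.

(** A path stopped at the larger threshold [N] either has also left below [n], or pauses on a wire
    between [n] and [N] and can be prolonged from there. *)
Lemma exit_widen (K : fieldType) (q n N : nat) (f : state -> outcome K q) s r :
  (n <= N)%N -> exit N f s r ->
  ((r.1.2 < n)%N -> exit n f s r) /\
  (forall r', (n <= r.1.2)%N -> exit n f r.1 r' ->
     exit n f s (r'.1, r'.2 *m r.2)).
Proof.
move=> nN; elim=> {s r} [s h|s r h _ [IH1 IH2]].
  by split=> [|r' h']; [exact: exit_now | exact: exit_later].
have nh := leq_trans nN h.
split=> /= [/IH1|r' h' /(IH2 _ h')]; first exact: exit_later.
by move=> /(exit_later nh); rewrite /= mulmxA.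
Qed.

(** Nested loops flatten: each step of [g] abbreviates a stretch of steps of [f], and the stretches
    concatenate to a path of [f]. *)
Lemma exit_exit (K : fieldType) (q n N : nat) (f g : state -> outcome K q) s r :
  (n <= N)%N -> (forall t, (t.2 < N)%N -> exit N f t (g t)) ->
  (s.2 < N)%N -> exit n g s r -> exit n f s r.
Proof.
move=> nN fg + h; elim: h => {s r} [s h|s r h _ IH] sN.
  exact: (exit_widen nN (fg _ sN)).1.
apply: (exit_widen nN (fg _ sN)).2 => //; apply: IH.
exact: exit_lt (fg _ sN).
Qed.

(** In the induction on [k], the inner traces stop below [n + 1] and the outermost one below [n];
    [exit_exit] flattens the two levels. *)
Lemma exit_run_tracen (K : fieldType) (q k n : nat) (D : pbs K q (n + k)) s :
  (s.2 < n)%N -> exit n (run D) s (run (tracen D) s).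
Proof.
elim: k n D s => [|k IH] n D s sn.
  rewrite /= run_cast; apply/exit_now.
  by rewrite -[X in (_ < X)%N]addn0 run_lt ?addn0.
apply: (@exit_exit _ _ _ (n + 1)); last 1 first.
- exact: (exit_run_Trace (tracen (cast (addnA n 1 k) D))).
- exact: leq_addr.
- move=> t tn; have := IH _ (cast (addnA n 1 k) D) _ tn.
  by rewrite run_cast.
- by rewrite addn1 ltnW.
Qed.

(** Both iterations read the same alternating word in [f] and [g], cut at different places. The
    extra [g] at the start of one gives the factor [(g t).2]; the extra [g] at the end of the other
    acts below [n], hence trivially. Quantifying over [t] lets the induction restart at
    [(f s).1]. *)
Lemma exit_slide (K : fieldType) (q n : nat) (f g : state -> outcome K q) s r :
  (forall t, (t.2 < n)%N -> g t = (t, 1%:M)) ->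
  (forall t, (n <= t.2)%N -> (n <= (g t).1.2)%N) ->
  exit n (fun t => andthen g (f t)) s r ->
  forall t, (g t).1 = s ->
  exit n (fun t => andthen f (g t)) t (r.1, r.2 *m (g t).2).
Proof.
move=> gid gge; elim=> {s r} [s|s r] /= h => [|_ IH] t gt.
  have fs : ((f s).1.2 < n)%N by rewrite ltnNge; apply/negP => /gge; lia.
  rewrite gid //= mul1mx -gt.
  by apply: (exit_now (f := fun t => andthen f (g t))); rewrite /= gt.
have fs : (n <= (f s).1.2)%N.
  by rewrite leqNgt; apply/negP => fs; move: h; rewrite gid //=; lia.
have := IH (f s).1 erefl; rewrite -gt => E.
have := @exit_later _ _ n (fun t => andthen f (g t)) t _ _ E.
by rewrite /= gt -!mulmxA; apply.
Qed.

(** * Soundness of the equations for paths *)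

(** Only states on the wires are compared: off them, the junk values of the two sides may differ, as
    in [st_swap_inv]. *)
Definition run_eq (K : fieldType) (q : nat) : pbs_rel K q :=
  fun n D D' => forall s, (s.2 < n)%N -> run D s = run D' s.

(** [R] is arbitrary because two closures are nested: the structural congruence, and the theory
    built over it. *)
Lemma run_eq_closure (K : fieldType) (q : nat) (R : pbs_rel K q) :
  (forall n (D D' : pbs K q n), R n D D' -> run_eq D D') ->
  forall n (D D' : pbs K q n), congr_closure R D D' -> run_eq D D'.
Proof.
move=> RE n D D'; elim=> {n D D'} /=.
- by move=> n D D' /RE.
- by [].
- by move=> n D D' _ IH s sn; rewrite IH.
- by move=> n D D' D'' _ IH1 _ IH2 s sn; rewrite IH1 ?IH2.
- move=> n D1 D1' D2 D2' _ IH1 _ IH2 s sn /=.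
  by rewrite /andthen -IH1 // IH2 // run_lt.
- move=> n m D1 D1' D2 D2' _ IH1 _ IH2 s sn /=.
  by case: ltnP => h; [exact: IH1 | rewrite IH2 //=; lia].
- move=> n D D' _ IH s sn.
  (* A single step of [run D] already ends below [n + 1], so each step of [run D'] is a one-step
     stretch in the sense of [exit_exit]. *)
  have fg t : (t.2 < n + 1)%N -> exit (n + 1) (run D) t (run D' t).
    by move=> tn; rewrite -IH //; apply: exit_now; exact: run_lt.
  apply: exit_uniq (exit_run_Trace D sn) _.
  apply: (exit_exit (leq_addr 1 n) fg _ (exit_run_Trace D' sn)).
  by rewrite addn1 ltnW.
Qed.

Lemma struct_axiom_run_eq (K : fieldType) (q n : nat) (D D' : pbs K q n) :
  struct_axiom D D' -> run_eq D D'.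
Proof.
case=> {n D D'} /=.
- by move=> n D1 D2 D3 s sn; rewrite /= /andthen /= mulmxA.
- by move=> n D s sn; rewrite /= /andthen run_idn ?run_lt //= mul1mx -surjective_pairing.
- by move=> n D s sn; rewrite /= /andthen run_idn //= mulmx1 -surjective_pairing.
- by move=> n D [c p] sn; rewrite /= subn0 add0n; case: (run _ _) => -[].
- by move=> n D s sn; rewrite run_cast /= sn.
- move=> n m k D1 D2 D3 s sn; rewrite run_cast /=.
  case: (ltnP s.2 (n + m)) => h1; case: (ltnP s.2 n) => h2 //=; try lia.
    by rewrite ifT //; lia.
  by rewrite ifF ?subnDA ?addnA //; lia.
- move=> n m D1 D3 D2 D4 s sn; rewrite /= /andthen.
  case: (ltnP s.2 n) => h /=; first by rewrite run_lt.
  by rewrite ltnNge leq_addr /= addKn -surjective_pairing.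
- move=> k D [c p] pk; rewrite /= run_cast /andthen (run_swap1 _ _ _ pk) /=.
  case: p pk => [|p] /= pk; first by rewrite run_swap1 //= ltnn subnn addn0.
  have pk' : (p < k)%N by [].
  have h : (1 + (run D (c, p)).1.2 < 1 + k)%N by exact: (run_lt D (s := (c, p))).
  rewrite subn1 /= pk' run_swap1 //=.
  by rewrite mul1mx mulmx1; case: (run _ _) => -[].
- move=> s sn; rewrite -/(idn 2) run_idn //.
  by case: s sn => c [|[|p]] //= _; rewrite /andthen /= mulmx1.
- move=> n m D1 D2 s sn; apply: exit_uniq (exit_run_Trace _ sn) _.
  rewrite run_cast.
  (* Paths of [D2] become paths of [D1 ⊗ D2] once shifted by [n]. *)
  have out t r : exit m (run D2) t r ->
      exit (n + m) (run (D1 ⊗ D2)) (t.1, n + t.2)%N ((r.1.1, n + r.1.2)%N, r.2).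
    have E t0 : run (D1 ⊗ D2) (t0.1, n + t0.2)%N =
        (((run D2 t0).1.1, n + (run D2 t0).1.2)%N, (run D2 t0).2).
      by rewrite /= ltnNge leq_addr /= addKn -surjective_pairing.
    elim=> {t r} [t h|t r h _ IH].
      by rewrite -E; apply: exit_now; rewrite E /= ltn_add2l.
    have := @exit_later _ _ (n + m) (run (D1 ⊗ D2)) (t.1, n + t.2)%N _ _ _.
    by move=> /(_ (_, _)); rewrite E /=; apply=> //; rewrite leq_add2l.
  case: (ltnP s.2 n) => h.
    (* A path entering through [D1] stays on its wires and leaves in one step. *)
    have -> : run (D1 ⊗ Trace D2) s = run (D1 ⊗ D2) s by rewrite /= h.
    apply: exit_now; rewrite /= h; apply: (leq_trans (run_lt D1 h)).
    exact: leq_addr.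
  have /exit_run_Trace/out : ((s.1, s.2 - n).2 < m)%N by rewrite /=; lia.
  by rewrite /= subnKC // -surjective_pairing ltnNge h.
- move=> n D1 D2 s sn; apply: exit_uniq (exit_run_Trace _ sn) _.
  (* On the looped wire [D1 ⊗ Wire] does nothing, so [D1] is met at the first step only. *)
  have in_out t r : (n <= t.2)%N -> (t.2 < n + 1)%N -> exit n (run D2) t r ->
      exit n (run (D2 ∘ (D1 ⊗ Wire))) t r.
    have E t0 : (n <= t0.2)%N -> run (D2 ∘ (D1 ⊗ Wire)) t0 = run D2 t0.
      move=> h; rewrite /= /andthen ltnNge h /= subnKC // mulmx1.
      by rewrite -!surjective_pairing.
    move=> + + h; elim: h => {t r} [t h|t r h _ IH] nt tn.
      by rewrite -E //; apply: exit_now; rewrite E.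
    by rewrite -E //; apply: exit_later; rewrite E //; apply: IH; rewrite ?run_lt.
  have E : run (D2 ∘ (D1 ⊗ Wire)) s = andthen (run D2) (run D1 s) by rewrite /= sn.
  have u := run_lt D1 sn.
  suff first_step t r : exit n (run D2) t r -> (run D1 s).1 = t ->
      exit n (run (D2 ∘ (D1 ⊗ Wire))) s (r.1, r.2 *m (run D1 s).2).
    exact: first_step (exit_run_Trace D2 u) erefl.
  case=> {t r} [t h|t r h h'] Et; subst t.
    by rewrite -/(andthen _ _) -E; apply: exit_now; rewrite E.
  rewrite /= -mulmxA.
  have := @exit_later _ _ n (run (D2 ∘ (D1 ⊗ Wire))) s r.
  rewrite E; apply=> //; apply: in_out => //.
  by apply: run_lt; rewrite addn1 ltnW.
- move=> n D1 D2 s sn; apply: exit_uniq (exit_run_Trace _ sn) _.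
  (* [D2] acts only on a state that has left the loop, hence once and last. *)
  have E t : run ((D2 ⊗ Wire) ∘ D1) t =
      if ((run D1 t).1.2 < n)%N then andthen (run D2) (run D1 t) else run D1 t.
    rewrite /= /andthen; case: ltnP => //= h.
    by rewrite subnKC // mul1mx -!surjective_pairing.
  suff out t r : exit n (run D1) t r ->
      exit n (run ((D2 ⊗ Wire) ∘ D1)) t (andthen (run D2) r).
    exact: out (exit_run_Trace D1 sn).
  elim=> {t r} [t h|t r h _ IH].
    have Et : run ((D2 ⊗ Wire) ∘ D1) t = andthen (run D2) (run D1 t) by rewrite E h.
    by rewrite -Et; apply: exit_now; rewrite Et run_lt.
  rewrite /andthen /= mulmxA.
  have := @exit_later _ _ n (run ((D2 ⊗ Wire) ∘ D1)) t (andthen (run D2) r).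
  by rewrite E ltnNge h; apply.
- move=> n k D1 D2 s sn.
  have gid t : (t.2 < n)%N -> run (idn n ⊗ D2) t = (t, 1%:M).
    by move=> tn; rewrite /= tn run_idn.
  have gge t : (n <= t.2)%N -> (n <= (run (idn n ⊗ D2) t).1.2)%N.
    by rewrite /= leqNgt => /negbTE -> /=; exact: leq_addr.
  have h := exit_run_tracen ((idn n ⊗ D2) ∘ D1) sn.
  have := exit_slide gid gge h (t := s); rewrite gid // => /(_ erefl).
  rewrite mulmx1 -surjective_pairing => /exit_uniq E.
  exact/E/(exit_run_tracen (D1 ∘ (idn n ⊗ D2)) sn).
- by move=> [c [|p]] //= _; rewrite /trace_run /= /andthen /= mulmx1.
Qed.

Lemma pbs_axiom_run_eq (K : fieldType) (q n : nat) (D D' : pbs K q n) :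
  pbs_axiom D D' -> run_eq D D'.
Proof.
case=> {n D D'}.
- by move=> [c [|p]].
- by move=> U [c [|p]] //=; rewrite /andthen /= mulmx1 mul1mx.
- by move=> U [[] [|[|p]]] //=; rewrite /andthen /= mulmx1 mul1mx.
(* No path meets [V]. A vertical input collects [U] and leaves after one turn on the left, after two
   on the right; a horizontal one leaves at once on both sides. *)
- by move=> U V [[] [|p]] //= _; rewrite /trace_run /= /andthen /= !(mulmx1, mul1mx).
- by move=> [[] [|[|p]]] //= _; rewrite /andthen /= !mulmx1.
- by move=> U V [c [|p]].
- by move=> U [c p].
- by move=> [[] [|[|p]]] //= _; rewrite /andthen /= !mulmx1.
- by move=> [[] [|[|[|p]]]] //= _; rewrite /andthen /= !mulmx1.
- by move=> [[] [|[|p]]] //= _; rewrite /andthen /= !mulmx1.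
Qed.

Lemma pbs_eq_run_eq (K : fieldType) (q n : nat) (D D' : pbs K q n) :
  pbs_eq D D' -> run_eq D D'.
Proof.
apply: run_eq_closure => {}n {}D {}D' [|]; last exact: pbs_axiom_run_eq.
by apply: run_eq_closure => {}n {}D {}D'; exact: struct_axiom_run_eq.
Qed.

(** * Linear maps on kets and direct sums *)

Lemma lfun_ket_ext (K : fieldType) (q n : nat) (W : vectType K)
    (f g : 'Hom(H K q n, W)) :
  (forall c p x, f (ket c p x) = g (ket c p x)) -> f = g.
Proof.
move=> fg; apply/lfunP => v.
suff -> : v = \sum_(b : basis q n)
    (v : {ffun basis q n -> K^o}) b *: ket b.1.1 b.1.2 b.2.
  by rewrite !linear_sum; apply: eq_bigr => b _; rewrite !linearZ /= fg.
apply/ffunP => b; rewrite sum_ffunE (bigD1 b) //= !ffunE -!surjective_pairing.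
rewrite eqxx /= big1 ?addr0 => [|b' /negPf nb].
  by rewrite /GRing.scale /= mulr1.
by rewrite !ffunE -!surjective_pairing eq_sym nb scaler0.
Qed.

(** [^-1] is a left inverse of an injective map; injectivity is read off the coordinate projections
    [fst_part] and [snd_part]. *)
Lemma glueK (K : fieldType) (q n m : nat) (uv : dsumv (H K q n) (H K q m)) :
  ((glue K q n m)^-1)%VF (glue K q n m uv) = uv.
Proof.
apply: lker0_lfunK.
pose fst_part : 'Hom(H K q (n + m), H K q n) :=
  linext (fun c p x => if split p is inl p' then ket c p' x else 0).
pose snd_part : 'Hom(H K q (n + m), H K q m) :=
  linext (fun c p x => if split p is inr p' then ket c p' x else 0).
have splitl p : split (lshift m p) = inl p by exact: (unsplitK (inl p)).
have splitr p : split (rshift n p) = inr p by exact: (unsplitK (inr p)).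
have fl : (fst_part \o linext (fun c p x => ket c (lshift m p) x) = \1)%VF.
  by apply: lfun_ket_ext => c p x; rewrite comp_lfunE !linext_ket splitl id_lfunE.
have fr : (fst_part \o linext (fun c p x => ket c (rshift n p) x) = 0)%VF.
  by apply: lfun_ket_ext => c p x; rewrite comp_lfunE !linext_ket splitr zero_lfunE.
have sl : (snd_part \o linext (fun c p x => ket c (lshift m p) x) = 0)%VF.
  by apply: lfun_ket_ext => c p x; rewrite comp_lfunE !linext_ket splitl zero_lfunE.
have sr : (snd_part \o linext (fun c p x => ket c (rshift n p) x) = \1)%VF.
  by apply: lfun_ket_ext => c p x; rewrite comp_lfunE !linext_ket splitr id_lfunE.
apply/lker0P => u v; rewrite !lfunE /= /glue_fun => e.
have := congr1 fst_part e; have := congr1 snd_part e.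
rewrite !linearD /= -!comp_lfunE fl fr sl sr !zero_lfunE !id_lfunE !addr0 !add0r.
by case: u v {e} => [u1 u2] [v1 v2] /= -> ->.
Qed.

Lemma boxplus_lshift (K : fieldType) (q n m : nat)
    (f : 'End(H K q n)) (g : 'End(H K q m)) c p x :
  boxplus f g (ket c (lshift m p) x) =
  linext (fun c p x => ket c (lshift m p) x) (f (ket c p x)).
Proof.
have -> : ket c (lshift m p) x = glue K q n m (ket c p x, 0).
  by rewrite lfunE /= /glue_fun linext_ket linear0 addr0.
by rewrite /boxplus !comp_lfunE glueK !lfunE /= /glue_fun /= !linear0 addr0 [LHS]lfunE.
Qed.

Lemma boxplus_rshift (K : fieldType) (q n m : nat)
    (f : 'End(H K q n)) (g : 'End(H K q m)) c p x :
  boxplus f g (ket c (rshift n p) x) =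
  linext (fun c p x => ket c (rshift n p) x) (g (ket c p x)).
Proof.
have -> : ket c (rshift n p) x = glue K q n m (0, ket c p x).
  by rewrite lfunE /= /glue_fun linext_ket linear0 add0r.
by rewrite /boxplus !comp_lfunE glueK !lfunE /= /glue_fun /= !linear0 add0r [LHS]lfunE.
Qed.

(* Total in the position [k], with junk value 0 off the wires. *)
Definition nket (K : fieldType) (q n : nat) (c : bool) (k : nat) (x : 'I_q) :
    H K q n :=
  oapp (fun p : 'I_n => ket c p x) 0 (insub k).

Lemma nketE (K : fieldType) (q n : nat) c (p : 'I_n) (x : 'I_q) :
  nket K n c p x = ket c p x.
Proof. by rewrite /nket valK. Qed.

Lemma nket_ge (K : fieldType) (q n : nat) c k (x : 'I_q) :
  (n <= k)%N -> nket K n c k x = 0.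
Proof. by move=> h; rewrite /nket insubN // -leqNgt. Qed.

(* The vector |c,p> ⊗ M|x> for [r = ((c, p), M)]. *)
Definition outv (K : fieldType) (q n : nat) (r : outcome K q) (x : 'I_q) :
    H K q n :=
  \sum_(y < q) r.2 y x *: nket K n r.1.1 r.1.2 y.

Lemma outv_ge (K : fieldType) (q n : nat) (r : outcome K q) (x : 'I_q) :
  (n <= r.1.2)%N -> outv n r x = 0.
Proof. by move=> h; apply: big1 => y _; rewrite nket_ge ?scaler0. Qed.

Lemma outv1 (K : fieldType) (q n : nat) c k (x : 'I_q) :
  outv n ((c, k), 1%:M) x = nket K n c k x.
Proof.
rewrite /outv (bigD1 x) //= mxE eqxx scale1r big1 ?addr0 // => y /negPf nyx.
by rewrite mxE nyx scale0r.
Qed.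

(** This is where composition of linear maps meets [andthen]: exchanging the two sums makes the
    entries of the matrix product appear. *)
Lemma lfun_outv (K : fieldType) (q n m : nat) (f : 'Hom(H K q n, H K q m))
    (g : state -> outcome K q) (r : outcome K q) x :
  (forall c (p : 'I_n) y, f (ket c p y) = outv m (g (c, val p)) y) ->
  (r.1.2 < n)%N -> f (outv n r x) = outv m (andthen g r) x.
Proof.
move=> fg h; rewrite linear_sum /= /outv.
under eq_bigr do
  rewrite linearZ /= -[r.1.2]/(val (Ordinal h)) nketE fg /= -surjective_pairing
    /outv scaler_sumr.
rewrite exchange_big; apply: eq_bigr => y _.
rewrite mxE scaler_suml; apply: eq_bigr => z _.
by rewrite scalerA mulrC.
Qed.

(** Meant for embeddings and projections, which affect the position and leave the matrix alone. *)
Lemma lfun_outv_nket (K : fieldType) (q n m : nat) (f : 'Hom(H K q n, H K q m))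
    (k : nat) (r : outcome K q) x :
  (forall y, f (nket K n r.1.1 r.1.2 y) = nket K m r.1.1 k y) ->
  f (outv n r x) = outv m ((r.1.1, k), r.2) x.
Proof.
move=> fg; rewrite linear_sum /=; apply: eq_bigr => y _.
by rewrite linearZ /= fg.
Qed.

(** * The trace as a finite sum *)

(** No case distinction appears because position [n] is off the [n] wires: the junk value 0 of
    [nket] agrees with what the projection kills. *)
Lemma tr_pi1_outv (K : fieldType) (q n : nat) (r : outcome K q) x :
  tr_pi1 K q n (outv (n + 1) r x) = outv n r x.
Proof.
rewrite (lfun_outv_nket (k := r.1.2)); first by case: r => -[].
move=> y; case: (ltnP r.1.2 (n + 1)) => h.
  rewrite -[r.1.2]/(val (Ordinal h)) nketE linext_ket.
  case: splitP => /= j e; first by rewrite e nketE.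
  by rewrite nket_ge // e leq_addr.
by rewrite !nket_ge ?linear0 //; lia.
Qed.

Lemma tr_pi0_outv (K : fieldType) (q n : nat) (r : outcome K q) x :
  tr_pi0 K q n (outv (n + 1) r x) = if (r.1.2 < n)%N then 0 else outv (n + 1) r x.
Proof.
have pi0_nket y : tr_pi0 K q n (nket K (n + 1) r.1.1 r.1.2 y) =
    if (r.1.2 < n)%N then 0 else nket K (n + 1) r.1.1 r.1.2 y.
  case: (ltnP r.1.2 (n + 1)) => h.
    by rewrite -[r.1.2]/(val (Ordinal h)) nketE linext_ket.
  by rewrite nket_ge // linear0 if_same.
case: ltnP pi0_nket => h pi0_nket; rewrite linear_sum /=.
  by apply: big1 => y _; rewrite linearZ /= pi0_nket scaler0.
by apply: eq_bigr => y _; rewrite linearZ /= pi0_nket.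
Qed.

(** One turn of the loop. A path that has left contributes nothing to later powers. *)
Lemma loop_outv (K : fieldType) (q n : nat) (f : 'End(H K q (n + 1)))
    (g : state -> outcome K q) (r : outcome K q) x :
  (forall c (p : 'I_(n + 1)) y, f (ket c p y) = outv (n + 1) (g (c, val p)) y) ->
  (r.1.2 < n + 1)%N ->
  (f \o tr_pi0 K q n)%VF (outv (n + 1) r x) =
  if (r.1.2 < n)%N then 0 else outv (n + 1) (andthen g r) x.
Proof.
move=> fg h; rewrite comp_lfunE tr_pi0_outv.
case: ltnP => _; first exact: linear0.
exact: lfun_outv.
Qed.

(** The term of index [k] sees a path only if it leaves after exactly [k] turns, so a single term
    survives, and it is the outcome of [trace_run]. *)
Lemma tr_sem_ket (K : fieldType) (q n : nat) (f : 'End(H K q (n + 1)))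
    (g : state -> outcome K q) c (p : 'I_n) x :
  permutes (n + 1) g ->
  (forall c (p : 'I_(n + 1)) y, f (ket c p y) = outv (n + 1) (g (c, val p)) y) ->
  tr_sem f (ket c p x) = outv n (trace_run n g (c, val p)) x.
Proof.
move=> gP fg; pose F := (f \o tr_pi0 K q n)%VF.
have powS k v : lfun_pow F k.+1 v = F (lfun_pow F k v) by exact: comp_lfunE.
have pow0 v : lfun_pow F 0 v = v by exact: id_lfunE.
have start c' (p' : 'I_n) x' :
    f (tr_incl K q n (ket c' p' x')) = outv (n + 1) (g (c', val p')) x'.
  by rewrite linext_ket fg.
have bounds s : (s.2 < n)%N ->
    [/\ ((g s).1.2 < n + 1)%N, ((andthen g (g s)).1.2 < n + 1)%N &
     ((trace_run n g s).1.2 < n)%N].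
  move=> sn; have b : ((g s).1.2 < n + 1)%N by apply: gP.1; lia.
  by split=> //; [exact: gP.1 | exact: (trace_run_permutes gP).1].
(* By [trace_run_permutes] every path has left after at most three applications of [f], so [tr_pi0]
   kills it by the third turn. *)
have pow3 c' (p' : 'I_n) x' k :
    lfun_pow F (3 + k) (f (tr_incl K q n (ket c' p' x'))) = 0.
  elim: k => [|k IH]; last by rewrite powS IH linear0.
  have [b1 b2] := bounds (c', val p') (ltn_ord p').
  rewrite !powS pow0 start (loop_outv _ fg) // /trace_run.
  case: (ltnP (g _).1.2) => h1 b3; first by rewrite !linear0.
  rewrite (loop_outv _ fg) //; move: b3.
  case: (ltnP (andthen _ _).1.2) => h2 b3; first by rewrite linear0.
  by rewrite comp_lfunE tr_pi0_outv b3 linear0.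
have termE k v : (tr_pi1 K q n \o (lfun_pow F k \o (f \o tr_incl K q n)))%VF v =
    tr_pi1 K q n (lfun_pow F k (f (tr_incl K q n v))).
  by rewrite !comp_lfunE.
(* The sum over all indices shrinks to those below 3, the other terms being zero maps by [pow3]. *)
rewrite /tr_sem -/F -(@fsbig_widen _ _ _ _ `I_3%classic) //=; last first.
  move=> k [_ /= /negP]; rewrite -leqNgt => /subnKC <-.
  apply: lfun_ket_ext => c' p' x'.
  by rewrite termE pow3 linear0 zero_lfunE.
rewrite -fsbig_ord !big_ord_recl big_ord0 !add_lfunE zero_lfunE addr0.
have [b1 b2] := bounds (c, val p) (ltn_ord p).
rewrite !termE !powS !pow0 start (loop_outv _ fg) // /trace_run tr_pi1_outv.
case: (ltnP (g _).1.2) => h1 b3; first by rewrite !linear0 !addr0.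
rewrite (outv_ge _ h1) add0r (loop_outv _ fg) // tr_pi1_outv; move: b3.
case: (ltnP (andthen _ _).1.2) => h2 b3; first by rewrite !linear0 !addr0.
by rewrite tr_pi1_outv (outv_ge _ h2) add0r.
Qed.

(** * From paths to the denotational semantics *)

Lemma sem_ket (K : fieldType) (q n : nat) (D : pbs K q n) c (p : 'I_n) x :
  sem D (ket c p x) = outv n (run D (c, val p)) x.
Proof.
elim: D c p x => {n} /=.
- by move=> c [].
- by move=> c p x; rewrite id_lfunE outv1 nketE.
- by move=> c p x; rewrite linext_ket outv1 nketE.
(* On two positions [rev_ord p] is [2 - p.+1], that is the [1 - p] of [run]. *)
- by move=> c p x; rewrite linext_ket outv1 -nketE /= subSS.
- by move=> c p x; rewrite linext_ket outv1 -nketE; case: c; rewrite //= subSS.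
- by move=> U c p x; rewrite linext_ket; apply: eq_bigr => y _; rewrite nketE.
- move=> n D2 IH2 D1 IH1 c p x; rewrite comp_lfunE IH1.
  by apply: lfun_outv => //; apply: run_lt; exact: ltn_ord.
- move=> n m D1 IH1 D2 IH2 c p x; case: (split_ordP p) => j -> /=.
    rewrite boxplus_lshift IH1; have := run_lt D1 (s := (c, val j)) (ltn_ord j).
    move: (run _ _) => r h; rewrite (lfun_outv_nket (k := r.1.2)).
      by case: r {h} => -[].
    by move=> y; rewrite -[r.1.2]/(val (Ordinal h)) nketE linext_ket -nketE.
  rewrite boxplus_rshift IH2 addKn.
  have := run_lt D2 (s := (c, val j)) (ltn_ord j).
  move: (run _ _) => r h; apply: lfun_outv_nket => y.
  by rewrite -[r.1.2]/(val (Ordinal h)) nketE linext_ket -nketE.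
- by move=> n D IH c p x; apply: tr_sem_ket => //; exact: run_permutes.
Qed.

Theorem proposition15 (R : realType) (q : nat) (hq : (1 <= q)%N) (n : nat)
    (D1 D2 : pbs (complex R) q n) :
  pbs_eq D1 D2 -> sem D1 = sem D2.
Proof.
move=> /pbs_eq_run_eq E; apply: lfun_ket_ext => c p x.
by rewrite !sem_ket E //; exact: ltn_ord.
Qed.
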